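(* There exist absolute constants $c,d>0$ such that the following holds for every finite-precision Lanczos run of $k$ completed iterations (for arbitrary $n$, symmetric $A\in\mathbb{R}^{n\times n}$, nonzero $v\in\mathbb{R}^n$, $k_{\max}$, $k\le k_{\max}$ and $0\le\varepsilon\le 1/(20k_{\max})$, as defined in the context). For every unit eigenpair $(\theta,y)$ of $T_k$ (that is, $T_ky=\theta y$ and $\|y\|=1$), the Ritz vector $x=V_ky$ satisfies $$|x^{\mathsf T}v_{k+1}|\cdot\beta_k|e_k^{\mathsf T}y|\le c\,k^d\,\varepsilon\|A\|.$$ (If the run terminates at step $k$, the left side is read as $|x^{\mathsf T}(\beta_kv_{k+1})|\,|e_k^{\mathsf T}y|=0$.)
   Context: Norms are Euclidean for vectors and spectral for matrices; $e_j$ denotes a standard basis vector. Finite-precision Lanczos run. Let $n,k_{\max}\ge1$ be integers, $A\in\mathbb{R}^{n\times n}$ symmetric, $v\in\mathbb{R}^n$ nonzero, and let the accuracy parameter satisfy $0\le\varepsilon\le 1/(20k_{\max})$. A run of $k$ completed iterations ($1\le k\le k_{\max}$) of the finite-precision symmetric Lanczos algorithm without reorthogonalization on $(A,v)$ consists of real vectors $v_j,u_j,w_j,z_j\in\mathbb{R}^n$ and real scalars $\alpha_j,\beta_j$ such that: $v_0=0$, $\beta_0=0$; $v_1$ satisfies $|v_1^{\mathsf T}v_1-1|\le\varepsilon$ and $\beta v_1=v+\Delta_0$ for some $\beta>0$ and some $\Delta_0$ with $\|\Delta_0\|\le\varepsilon\|v\|$; and for $j=1,\dots,k$ there are errors with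 $$u_j=Av_j+e^u_j,\quad \|e^u_j\|\le\varepsilon\|A\|\|v_j\|;$$ $$w_j=u_j-\beta_{j-1}v_{j-1}+e^w_j,\quad \|e^w_j\|\le\varepsilon(\|u_j\|+\beta_{j-1}\|v_{j-1}\|);$$ $$\alpha_j=v_j^{\mathsf T}w_j+e^\alpha_j,\quad |e^\alpha_j|\le\varepsilon\|v_j\|\|w_j\|;$$ $$z_j=w_j-\alpha_jv_j+e^z_j,\quad \|e^z_j\|\le\varepsilon(\|w_j\|+|\alpha_j|\|v_j\|).$$ If $z_j\ne0$ then $\beta_j>0$, $\beta_jv_{j+1}=z_j+\Delta_j$ with $\|\Delta_j\|\le\varepsilon\|z_j\|$, and $|v_{j+1}^{\mathsf T}v_{j+1}-1|\le\varepsilon$. If $z_j=0$ then $\beta_j=0$ and the algorithm terminates. Termination can occur only at $j=k$, so $\beta_1,\dots,\beta_{k-1}>0$. If the run terminates at step $k$, $v_{k+1}$ is not formed and by convention $\Delta_k=0$ and $\beta_kv_{k+1}=0$. $V_k=[v_1,\dots,v_k]\in\mathbb{R}^{n\times k}$, and $T_k\in\mathbb{R}^{k\times k}$ is the symmetric tridiagonal matrix with diagonal $\alpha_1,\dots,\alpha_k$ and off-diagonal entries $\beta_1,\dots,\beta_{k-1}$. *)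

(* Defs.v *)
From HB Require Import structures.
From mathcomp Require Import all_boot all_order all_algebra.
From mathcomp Require Import all_classical all_reals.
From mathcomp Require Export exp.

Set Implicit Arguments.
Unset Strict Implicit.
Unset Printing Implicit Defensive.

Import Order.TTheory GRing.Theory Num.Theory.

Local Open Scope classical_set_scope.
Local Open Scope ring_scope.

(* The norm that MathComp-Analysis puts on matrices is the max norm, so the
   Euclidean and spectral norms are defined here. *)

Definition dotv (R : realType) (n : nat) (x y : 'cV[R]_n) : R :=
  (x^T *m y) 0 0.

Definition enorm (R : realType) (n : nat) (x : 'cV[R]_n) : R :=
  Num.sqrt (\sum_(i < n) x i 0 ^+ 2).

Definition specnorm (R : realType) (m n : nat) (A : 'M[R]_(m, n)) : R :=
  sup [set enorm (A *m x) | x in [set x : 'cV[R]_n | enorm x <= 1]].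

(* e_j, with 1-based index j; it is the zero vector unless 1 <= j <= n. *)
Definition stdvec (R : realType) (n j : nat) : 'cV[R]_n :=
  \col_(i < n) (i.+1 == j)%:R.

(* Sequences are indexed as in the mathematics: vs j is v_j (j = 0, ..., k+1),
   us j, ws j, zs j are u_j, w_j, z_j (j = 1, ..., k), and so on; the values at
   other indices are unconstrained.  In particular vs k.+1 is arbitrary when the
   run terminates at step k, in which case bs k = 0. *)
Record lanczos_data (R : realType) (n : nat) := LanczosData {
  vs : nat -> 'cV[R]_n;
  us : nat -> 'cV[R]_n;
  ws : nat -> 'cV[R]_n;
  zs : nat -> 'cV[R]_n;
  als : nat -> R;
  bs : nat -> R }.

Definition lanczos_start (R : realType) (n : nat) (v : 'cV[R]_n) (eps : R)
    (L : lanczos_data R n) : Prop :=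
  [/\ vs L 0%N = 0,
      bs L 0%N = 0,
      `|dotv (vs L 1%N) (vs L 1%N) - 1| <= eps &
      exists (b : R) (D0 : 'cV[R]_n),
        [/\ 0 < b, b *: vs L 1%N = v + D0 & enorm D0 <= eps * enorm v]].

Definition lanczos_step (R : realType) (n : nat) (A : 'M[R]_n) (eps : R)
    (k : nat) (L : lanczos_data R n) (j : nat) : Prop :=
  [/\ exists eu : 'cV[R]_n,
        us L j = A *m vs L j + eu /\
        enorm eu <= eps * specnorm A * enorm (vs L j),
      exists ew : 'cV[R]_n,
        ws L j = us L j - bs L j.-1 *: vs L j.-1 + ew /\
        enorm ew <= eps * (enorm (us L j) + bs L j.-1 * enorm (vs L j.-1)),
      exists ea : R,
        als L j = dotv (vs L j) (ws L j) + ea /\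
        `|ea| <= eps * enorm (vs L j) * enorm (ws L j),
      exists ez : 'cV[R]_n,
        zs L j = ws L j - als L j *: vs L j + ez /\
        enorm ez <= eps * (enorm (ws L j) + `|als L j| * enorm (vs L j)) &
      (zs L j != 0 ->
         [/\ 0 < bs L j,
             exists D : 'cV[R]_n,
               bs L j *: vs L j.+1 = zs L j + D /\
               enorm D <= eps * enorm (zs L j) &
             `|dotv (vs L j.+1) (vs L j.+1) - 1| <= eps]) /\
      (zs L j = 0 -> bs L j = 0 /\ j = k)].

Definition lanczos_run (R : realType) (n : nat) (A : 'M[R]_n) (v : 'cV[R]_n)
    (eps : R) (k : nat) (L : lanczos_data R n) : Prop :=
  lanczos_start v eps L /\
  forall j : nat, (1 <= j <= k)%N -> lanczos_step A eps k L j.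

Definition lanczosV (R : realType) (n : nat) (L : lanczos_data R n) (k : nat) :
    'M[R]_(n, k) :=
  \matrix_(i < n, j < k) vs L j.+1 i 0.

Definition lanczosT (R : realType) (n : nat) (L : lanczos_data R n) (k : nat) :
    'M[R]_k :=
  \matrix_(i < k, j < k)
    if i == j then als L i.+1
    else if (j == i.+1 :> nat) then bs L i.+1
    else if (i == j.+1 :> nat) then bs L j.+1
    else 0.

(* Main.v *)
(* Following Paige, the computed vectors satisfy a perturbed recurrence
     be_j v_{j+1} + al_j v_j + be_{j-1} v_{j-1} = A v_j + f_j
   with f_j and be_j <v_j, v_{j+1}> of size O(k eps |A|).  Here the crude bound
   be_j <= (1 + 20 eps) (|A| + be_{j-1}) suffices: as eps <= 1/(20 k), it gives
   be_j <= e k |A|.  For the partial Ritz sums X_j = sum_{i < j} y_i v_i, the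
   symmetry of A and T_k y = theta y make the quantity
     be_j y_{j+1} <X_j, v_j> - be_j y_j <X_{j+1}, v_{j+1}>
   change by O(k^2 eps |A|) from one j to the next.  It vanishes at j = 0, and at
   j = k it is - be_k y_k <x, v_{k+1}> because y_{k+1} = 0.  This is the
   quadratic-form version of Paige's commutator identity for T_k and the strictly
   upper triangular part of V_k^T V_k. *)

Require Import Defs.
From mathcomp Require Import all_boot all_order all_algebra.
From mathcomp Require Import all_classical all_reals.
From mathcomp Require Import exp.
From mathcomp Require Import ring lra.

Set Implicit Arguments.
Unset Strict Implicit.
Unset Printing Implicit Defensive.

Import Order.TTheory GRing.Theory Num.Theory.
Local Open Scope ring_scope.

(** * Inner product and Euclidean norm *)

Section EuclideanNorm.
Variables (R : realType) (n : nat).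
Implicit Types (x y z : 'cV[R]_n) (a : R).

Lemma dotvE x y : dotv x y = \sum_i x i 0 * y i 0.
Proof. by rewrite /dotv mxE; apply: eq_bigr => i _; rewrite mxE. Qed.

Lemma dotvC x y : dotv x y = dotv y x.
Proof. by rewrite !dotvE; apply: eq_bigr => i _; rewrite mulrC. Qed.

Lemma dotvDl x y z : dotv (x + y) z = dotv x z + dotv y z.
Proof. by rewrite /dotv raddfD mulmxDl mxE. Qed.

Lemma dotvZl a x y : dotv (a *: x) y = a * dotv x y.
Proof. by rewrite /dotv linearZ -scalemxAl mxE. Qed.

Lemma dotvNl x y : dotv (- x) y = - dotv x y.
Proof. by rewrite -scaleN1r dotvZl mulN1r. Qed.

Lemma dotvDr x y z : dotv x (y + z) = dotv x y + dotv x z.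
Proof. by rewrite dotvC dotvDl !(dotvC x). Qed.

Lemma dotvZr a x y : dotv x (a *: y) = a * dotv x y.
Proof. by rewrite dotvC dotvZl (dotvC x). Qed.

Lemma dotvNr x y : dotv x (- y) = - dotv x y.
Proof. by rewrite dotvC dotvNl (dotvC x). Qed.

Definition dotv_lin := (dotvDl, dotvDr, dotvZl, dotvZr, dotvNl, dotvNr).

Lemma dotv_mulmxl (A : 'M[R]_n) x y : A^T = A -> dotv (A *m x) y = dotv x (A *m y).
Proof. by move=> sA; rewrite /dotv trmx_mul sA mulmxA. Qed.

Lemma enorm_ge0 x : 0 <= enorm x.
Proof. exact: sqrtr_ge0. Qed.

Lemma sqr_enorm x : enorm x ^+ 2 = dotv x x.
Proof.
rewrite sqr_sqrtr; last by apply: sumr_ge0 => i _; exact: sqr_ge0.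
by rewrite dotvE; apply: eq_bigr => i _; rewrite expr2.
Qed.

Lemma enorm_le x a : 0 <= a -> dotv x x <= a ^+ 2 -> enorm x <= a.
Proof. by move=> a0; rewrite -sqr_enorm ler_sqr ?nnegrE ?enorm_ge0. Qed.

Lemma dotv_ge0 x : 0 <= dotv x x.
Proof. by rewrite -sqr_enorm sqr_ge0. Qed.

Lemma enorm0 : enorm (0 : 'cV[R]_n) = 0.
Proof.
apply/eqP; rewrite -sqrf_eq0 sqr_enorm dotvE big1 // => i _.
by rewrite !mxE mul0r.
Qed.

Lemma enormZ a x : enorm (a *: x) = `|a| * enorm x.
Proof.
apply/eqP; rewrite -(@eqrXn2 _ 2) ?mulr_ge0 ?enorm_ge0 //; apply/eqP.
by rewrite exprMn !sqr_enorm real_normK ?num_real // !dotv_lin; ring.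
Qed.

Lemma norm_coord_le x i : `|x i 0| <= enorm x.
Proof.
rewrite -ler_sqr ?nnegrE ?enorm_ge0 // sqr_enorm real_normK ?num_real //.
rewrite dotvE (bigD1 i) //= -expr2 lerDl; apply: sumr_ge0 => j _.
by rewrite -expr2 sqr_ge0.
Qed.

Lemma enorm0_eq0 x : enorm x = 0 -> x = 0.
Proof.
move=> x0; apply/colP => i; rewrite mxE; apply/eqP.
by rewrite -normr_eq0 eq_le normr_ge0 -x0 norm_coord_le.
Qed.

(** Cauchy-Schwarz: expand the nonnegative square of |y| x - |x| y and divide by |x| |y|; zero
    vectors are treated apart because of the division. *)
Lemma dotv_le x y : dotv x y <= enorm x * enorm y.
Proof.
have := enorm_ge0 x; rewrite le_eqVlt => /predU1P[|x0].
  by move=> /esym /enorm0_eq0 ->; rewrite enorm0 dotvE big1 ?mul0r // => i _;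
     rewrite !mxE mul0r.
have := enorm_ge0 y; rewrite le_eqVlt => /predU1P[|y0].
  by move=> /esym /enorm0_eq0 ->; rewrite enorm0 dotvE big1 ?mulr0 // => i _;
     rewrite !mxE mulr0.
have := dotv_ge0 (enorm y *: x - enorm x *: y).
rewrite !dotv_lin (dotvC y x) -!sqr_enorm => h.
have xy0 : 0 < enorm x * enorm y by exact: mulr_gt0.
rewrite -(ler_pM2l xy0); lra.
Qed.

Lemma norm_dotv_le x y : `|dotv x y| <= enorm x * enorm y.
Proof.
rewrite ler_norml dotv_le andbT lerNl -dotvNl (le_trans (dotv_le _ _)) //.
by rewrite -scaleN1r enormZ normrN1 mul1r.
Qed.

Lemma enormD x y : enorm (x + y) <= enorm x + enorm y.
Proof.
apply: enorm_le; first by rewrite addr_ge0 ?enorm_ge0.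
rewrite !dotv_lin (dotvC y x) sqrrD !sqr_enorm.
have := dotv_le x y; lra.
Qed.

Lemma enormN x : enorm (- x) = enorm x.
Proof. by rewrite -scaleN1r enormZ normrN1 mul1r. Qed.

End EuclideanNorm.

(** * The spectral norm as an operator bound *)

Section SpectralNorm.
Variables (R : realType) (n : nat) (A : 'M[R]_n).

Lemma specnorm_ub (x : 'cV[R]_n) : enorm x <= 1 -> enorm (A *m x) <= specnorm A.
Proof.
move=> x1; apply: sup_upper_bound; last by exists x.
split; first by exists (enorm (A *m x)); exists x.
(* The supremum is an upper bound only once the set is known to be bounded. Coordinates of the unit
   ball are at most 1, so absolute row sums bound the entries of A z. *)
exists (Num.sqrt (\sum_i (\sum_j `|A i j|) ^+ 2)) => _ [z /= z1 <-].
rewrite /enorm ler_sqrt; last by apply: sumr_ge0 => i _; exact: sqr_ge0.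
apply: ler_sum => i _; rewrite mxE -[leLHS]real_normK ?num_real //.
rewrite ler_sqr ?nnegrE ?normr_ge0 ?sumr_ge0 //.
apply: le_trans (ler_norm_sum _ _ _) _; apply: ler_sum => j _.
by rewrite normrM ler_piMr // (le_trans (norm_coord_le z j)).
Qed.

Lemma specnorm_ge0 : 0 <= specnorm A.
Proof.
by rewrite (le_trans (enorm_ge0 (A *m 0))) // specnorm_ub // enorm0.
Qed.

Lemma enorm_mulmx_le (x : 'cV[R]_n) : enorm (A *m x) <= specnorm A * enorm x.
Proof.
have := enorm_ge0 x; rewrite le_eqVlt => /predU1P[/esym/enorm0_eq0 ->|x0].
  by rewrite mulmx0 enorm0 mulr0.
rewrite -ler_pdivrMr // mulrC.
have -> : (enorm x)^-1 * enorm (A *m x) = enorm (A *m ((enorm x)^-1 *: x)).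
  by rewrite -scalemxAr enormZ ger0_norm // invr_ge0 ltW.
by rewrite specnorm_ub // enormZ gtr0_norm ?invr_gt0 // mulVf ?gt_eqF.
Qed.

End SpectralNorm.

(** * The perturbed three-term recurrence, apart from its Lanczos origin *)

Section ThreeTermRecurrence.
Variables (R : realType) (n k : nat) (A : 'M[R]_n) (v : nat -> 'cV[R]_n).
Variables (al be Y : nat -> R) (theta phi delta eta : R).
Hypothesis sA : A^T = A.
Hypotheses (be0 : be 0%N = 0) (Y0 : Y 0%N = 0) (Yk1 : Y k.+1 = 0).
Hypothesis eigenY : forall i, (i < k)%N ->
  be i * Y i + al i.+1 * Y i.+1 + be i.+1 * Y i.+2 = theta * Y i.+1.
Hypothesis Y1 : forall i, `|Y i| <= 1.
Hypothesis v2 : forall i, (i <= k)%N -> enorm (v i) <= 2.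

(* f i is the local error of step i + 1. *)
Let f i := be i.+1 *: v i.+2 + al i.+1 *: v i.+1 + be i *: v i - A *m v i.+1.

Hypothesis f_phi : forall i, (i < k)%N -> enorm (f i) <= phi.
Hypothesis be_delta : forall i, (i <= k)%N ->
  `|be i * dotv (v i) (v i.+1)| <= delta.
Hypothesis be_eta : forall i, (i < k)%N ->
  `|be i * (dotv (v i) (v i) - dotv (v i.+1) (v i.+1))| <= eta.

Let X j := \sum_(i < j) Y i *: v i.

Let XS j : X j.+1 = X j + Y j *: v j.
Proof. by rewrite /X big_ord_recr. Qed.

Let X_le j : (j <= k.+1)%N -> enorm (X j) <= 2 * j%:R.
Proof.
elim: j => [|j IH] jk; first by rewrite /X big_ord0 enorm0 mulr0.
rewrite XS (le_trans (enormD _ _)) // -[j.+1%:R]natr1 mulrDr lerD ?IH ?(ltnW jk) //.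
rewrite mulr1 enormZ (le_trans _ (v2 jk)) // ler_piMl ?enorm_ge0 //.
Qed.

(* The residual of X_{i+1} as an eigenvector of A, corrected by the boundary term
   left by the shift of summation index; it equals sum_{j <= i} Y_j f_j. *)
Let r i := theta *: X i.+1 - A *m X i.+1
  - be i *: (Y i.+1 *: v i - Y i *: v i.+1).

Let r_le i : (i <= k)%N -> enorm (r i) <= i%:R * phi.
Proof.
elim: i => [|i IH] ik.
  rewrite /r XS /X big_ord0 Y0 be0 !scale0r addr0 mulmx0 scaler0 !subr0.
  by rewrite enorm0 mul0r.
(* The eigenvector equation, multiplied by each coordinate of v_{i+1}, eliminates theta; the
   remaining terms assemble into the local error. *)
have -> : r i.+1 = r i + Y i.+1 *: f i.
  rewrite /r /f (XS i.+1) mulmxDr -scalemxAr.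
  move: (A *m X i.+1) (A *m v i.+1) (X i.+1) => AX Av Xi.
  apply/colP => l; rewrite !mxE.
  have /(congr1 ( *%R^~ (v i.+1 l 0))) /= := eigenY ik; lra.
rewrite (le_trans (enormD _ _)) // -[i.+1%:R]natr1 mulrDl mul1r.
rewrite lerD ?IH ?(ltnW ik) // enormZ (le_trans _ (f_phi ik)) //.
by rewrite ler_piMl ?enorm_ge0.
Qed.

Let g i := be i * Y i.+1 * dotv (X i) (v i)
  - be i * Y i * dotv (X i.+1) (v i.+1).

(** Symmetry of A cancels <A X_{i+1}, v_{i+1}> against <X_{i+1}, A v_{i+1}>, and the eigenvector
    equation times <X_{i+1}, v_{i+1}> removes theta. What remains is loss of local orthogonality,
    drift of the norms, and residuals. *)
Let gS i : (i < k)%N -> g i.+1 = g i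
  + Y i.+1 ^+ 2 * (be i * dotv (v i) (v i.+1) - be i.+1 * dotv (v i.+1) (v i.+2))
  + Y i * Y i.+1 * (be i * (dotv (v i) (v i) - dotv (v i.+1) (v i.+1)))
  + Y i.+1 * (dotv (r i) (v i.+1) - dotv (X i.+1) (f i)).
Proof.
move=> ik; rewrite /g /r /f !dotv_lin dotv_mulmxl // (XS i.+1) !dotv_lin.
have -> : dotv (X i) (v i) = dotv (X i.+1) (v i) - Y i * dotv (v i) (v i).
  by rewrite (XS i) !dotv_lin; ring.
have /(congr1 ( *%R^~ (dotv (X i.+1) (v i.+1)))) /= := eigenY ik; lra.
Qed.

(** The k increments of [g] are summed from [g 0 = 0]. Each costs 2 delta for orthogonality, eta for
    the norms, and 2 k phi for each of <r_i, v_{i+1}> and <X_{i+1}, f_i>. The vector [v k.+1] enters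
    the hypotheses only multiplied by [be k], so terminated runs are covered. *)
Lemma three_term_bound :
  `|dotv (\sum_(i < k.+1) Y i *: v i) (v k.+1)| * `|be k * Y k|
    <= k%:R * (2 * delta + eta + 4 * k%:R * phi).
Proof.
have phi0 i : (i < k)%N -> 0 <= phi.
  by move=> ik; exact: le_trans (enorm_ge0 _) (f_phi ik).
have gle i : (i <= k)%N -> `|g i| <= i%:R * (2 * delta + eta + 4 * k%:R * phi).
  elim: i => [|i IH] ik.
    by rewrite /g be0 !mul0r subrr normr0.
  rewrite gS // -[i.+1%:R]natr1 mulrDl mul1r -2!addrA.
  have hk : i.+1%:R <= k%:R :> R by rewrite ler_nat.
  have p0 := phi0 _ ik.
  apply: le_trans (ler_normD _ _) _; apply: lerD; first exact: IH (ltnW ik).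
  apply: le_trans (ler_normD _ _) _; rewrite -[2 * _ + _ + _]addrA.
  apply: lerD.
    rewrite normrM -[leRHS]mul1r ler_pM ?normr_ge0 //.
      by rewrite normrX exprn_ile1.
    apply: le_trans (ler_normB _ _) _.
    by have := be_delta (ltnW ik); have := be_delta ik; lra.
  apply: le_trans (ler_normD _ _) _; apply: lerD.
    rewrite normrM -[leRHS]mul1r ler_pM ?normr_ge0 ?be_eta //.
    by rewrite normrM mulr_ile1.
  rewrite normrM -[leRHS]mul1r ler_pM ?normr_ge0 //.
  apply: le_trans (ler_normB _ _) _.
  have h1 : `|dotv (r i) (v i.+1)| <= (k%:R * phi) * 2.
    apply: le_trans (norm_dotv_le _ _) _.
    rewrite ler_pM ?enorm_ge0 ?v2 // (le_trans (r_le (ltnW ik))) //.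
    by rewrite ler_wpM2r // ler_nat ltnW.
  have h2 : `|dotv (X i.+1) (f i)| <= (2 * k%:R) * phi.
    apply: le_trans (norm_dotv_le _ _) _.
    rewrite ler_pM ?enorm_ge0 ?f_phi // (le_trans (X_le (leqW ik))) //.
    by rewrite ler_wpM2l.
  lra.
have := gle k (leqnn k).
by rewrite /g Yk1 mulr0 mul0r sub0r normrN normrM mulrC.
Qed.

End ThreeTermRecurrence.

(** * Rounding errors of one step and growth of the be_j *)

(** The errors are propagated through u, w, al, z in turn, on the scale N = |A| + be_{j-1}. The
    constants 20 and 10 leave slack. *)
Lemma lanczos_step_bounds (R : realType) (n : nat) (A : 'M[R]_n) (eps : R)
    (k : nat) (L : lanczos_data R n) (j : nat) :
  let N := specnorm A + bs L j.-1 in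
  0 <= eps -> 20 * eps <= 1 -> lanczos_step A eps k L j ->
  `|dotv (vs L j) (vs L j) - 1| <= eps ->
  0 <= bs L j.-1 -> bs L j.-1 * enorm (vs L j.-1) <= (1 + eps) * bs L j.-1 ->
  [/\ 0 <= bs L j, bs L j <= (1 + 20 * eps) * N,
      `|bs L j * dotv (vs L j) (vs L j.+1)| <= 10 * eps * N &
      enorm (bs L j *: vs L j.+1 + als L j *: vs L j
             + bs L j.-1 *: vs L j.-1 - A *m vs L j) <= 10 * eps * N].
Proof.
set b := bs L j.-1; set v := vs L j; set p := enorm (vs L j.-1).
set a := specnorm A => /= e0 e1 [[eu [Eu heu]] [ew [Ew hew]] [ea [Ea hea]]].
move=> [ez [Ez hez]] [znz zz] hv b0 hp.
have a0 : 0 <= a by exact: specnorm_ge0.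
(* Since eps <= 1/20, second-order terms are absorbed into first-order ones; this and its analogues
   below keep the estimates within reach of [lra]. *)
have ee : eps * eps <= eps / 20 by rewrite ler_wpM2l //; lra.
have ee0 : 0 <= eps * eps by exact: mulr_ge0.
have hvv : 1 - eps <= dotv v v <= 1 + eps by move: hv; rewrite ler_distl.
have v1 : enorm v <= 1 + eps by apply: enorm_le; [lra | rewrite expr2; lra].
have v0 := enorm_ge0 v; have w0 := enorm_ge0 (ws L j).
(* Termination is merged with the regular case by taking D = 0. Otherwise |v_{j+1}|^2 >= 1 - eps >=
   (1 - eps)^2 gives the last bound. *)
have [D [ED hD hb0 hb]] : exists D, [/\ bs L j *: vs L j.+1 = zs L j + D,
    enorm D <= eps * enorm (zs L j), 0 <= bs L j &
    bs L j * (1 - eps) <= enorm (bs L j *: vs L j.+1)].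
  have [z0|zn0] := eqVneq (zs L j) 0.
    exists 0; rewrite z0 (zz z0).1 scale0r addr0 enorm0 mulr0 mul0r.
    by split.
  have [bp [D [ED hD]] hv'] := znz zn0; exists D; split=> //; first exact: ltW.
  rewrite enormZ gtr0_norm // ler_wpM2l ?(ltW bp) //.
  rewrite -ler_sqr ?nnegrE ?enorm_ge0 ?sqr_enorm //; last lra.
  by move: hv'; rewrite ler_distl expr2; lra.
have av : a * enorm v <= (1 + eps) * a by rewrite mulrC ler_wpM2r.
have ea0 : 0 <= eps * a by exact: mulr_ge0.
have eb0 : 0 <= eps * b by exact: mulr_ge0.
have eea : eps * (eps * a) <= (eps * a) / 20.
  by rewrite mulrC ler_wpM2l //; lra.
have eeb : eps * (eps * b) <= (eps * b) / 20.
  by rewrite mulrC ler_wpM2l //; lra.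
have heu' : enorm eu <= 11 / 10 * (eps * a).
  apply: le_trans heu _; rewrite -mulrA.
  apply: le_trans (ler_wpM2l e0 av) _; lra.
have hu : enorm (us L j) <= (1 + 43 / 20 * eps) * a.
  rewrite Eu; apply: le_trans (enormD _ _) _.
  by have := enorm_mulmx_le A v; rewrite -/a; lra.
have hup : enorm (us L j) + b * p <= (1 + 43 / 20 * eps) * (a + b) by lra.
have hew' : enorm ew <= 12 / 10 * (eps * (a + b)).
  apply: le_trans hew _; apply: le_trans (ler_wpM2l e0 hup) _; lra.
have hw : enorm (ws L j) <= (1 + 4 * eps) * (a + b).
  rewrite Ew; apply: le_trans (enormD _ _) _.
  have := enormD (us L j) (- (b *: vs L j.-1)).
  by rewrite enormN enormZ (ger0_norm b0) -/p; lra.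
set W := enorm (ws L j) in w0 hw hea hez *.
have eW0 : 0 <= eps * W by exact: mulr_ge0.
have eeW : eps * (eps * W) <= (eps * W) / 20.
  by rewrite mulrC ler_wpM2l //; lra.
have eW : eps * W <= 12 / 10 * (eps * (a + b)).
  by apply: le_trans (ler_wpM2l e0 hw) _; lra.
have vW : enorm v * W <= (1 + eps) * W by rewrite ler_wpM2r.
have hs : `|dotv v (ws L j)| <= (1 + eps) * W.
  exact: le_trans (norm_dotv_le _ _) vW.
have hea' : `|ea| <= 21 / 20 * (eps * W).
  by apply: le_trans hea _; rewrite -mulrA; have := ler_wpM2l e0 vW; lra.
have hal : `|als L j| <= 6 / 5 * W.
  by rewrite Ea; apply: le_trans (ler_normD _ _) _; have := ler_wpM2r w0 e1; lra.
have hez' : enorm ez <= 23 / 10 * (eps * W).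
  apply: le_trans hez _.
  have : `|als L j| * enorm v <= 6 / 5 * W * (1 + eps) by rewrite ler_pM.
  by move=> /(ler_wpM2l e0); lra.
(* With al = s + ea and s = <v, w>, the square of this norm is
   W^2 - s^2 (2 - |v|^2) - 2 s ea (1 - |v|^2) + ea^2 |v|^2. *)
have hq : enorm (ws L j - als L j *: v) <= (1 + eps) * W.
  apply: enorm_le; first by rewrite mulr_ge0 //; lra.
  rewrite !dotv_lin (dotvC _ v) -(sqr_enorm (ws L j)) -/W Ea.
  set s := dotv v (ws L j) in hs *.
  have h1 : `|s * ea * (1 - dotv v v)| <= (1 + eps) * W * (21 / 20 * (eps * W)) * eps.
    by rewrite normrM ler_pM // ?(distrC 1) // normrM ler_pM.
  have h2 : ea ^+ 2 <= (21 / 20 * (eps * W)) ^+ 2.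
    by rewrite -[leLHS]real_normK ?num_real // ler_sqr ?nnegrE //; lra.
  have h3 : ea ^+ 2 * dotv v v <= (21 / 20 * (eps * W)) ^+ 2 * (1 + eps).
    by rewrite ler_pM ?sqr_ge0 ?dotv_ge0 //; lra.
  have h4 : 0 <= s ^+ 2 * (2 - dotv v v) by rewrite mulr_ge0 ?sqr_ge0 //; lra.
  have h5 : 0 <= eps * W * W by rewrite mulr_ge0.
  have h6 : eps * (eps * W * W) <= (eps * W * W) / 20.
    by rewrite mulrC ler_wpM2l //; lra.
  have h7 := ler_wpM2l e0 h6.
  have h8 : 0 <= eps * (eps * W * W) by rewrite mulr_ge0.
  by move: h1; rewrite ler_norml => /andP[h1 _]; lra.
(* The leading factor is 1 because subtracting al v is nearly an orthogonal projection. The triangle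
   inequality alone would give about 2, and a bound on be_j growing exponentially in j. *)
have hz : enorm (zs L j) <= (1 + 33 / 10 * eps) * W.
  by rewrite Ez; apply: le_trans (enormD _ _) _; lra.
have hD' : enorm D <= 12 / 10 * (eps * W).
  by apply: le_trans hD _; have := ler_wpM2l e0 hz; lra.
have eab0 : 0 <= eps * (a + b) by rewrite mulr_ge0 // addr_ge0.
have eeab : eps * (eps * (a + b)) <= (eps * (a + b)) / 20.
  by rewrite mulrC ler_wpM2l //; lra.
split=> //.
- rewrite -(@ler_pM2r _ (1 - eps)); last lra.
  apply: le_trans hb _; rewrite ED; apply: le_trans (enormD _ _) _; lra.
(* Replacing <v, w> by al - ea leaves only terms that carry a rounding error or the defect 1 -
   |v|^2. *)
- have -> : bs L j * dotv v (vs L j.+1) =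
      - ea + als L j * (1 - dotv v v) + dotv v ez + dotv v D.
    rewrite -dotvZr ED Ez Ea !dotv_lin; ring.
  have hvx (x : 'cV[R]_n) : `|dotv v x| <= 21 / 20 * enorm x.
    apply: le_trans (norm_dotv_le _ _) _.
    by rewrite ler_wpM2r ?enorm_ge0 //; lra.
  have h1 : `|als L j * (1 - dotv v v)| <= 6 / 5 * W * eps.
    by rewrite normrM ler_pM // distrC.
  have n3 (p1 p2 p3 p4 : R) :
      `|p1 + p2 + p3 + p4| <= `|p1| + `|p2| + `|p3| + `|p4|.
    by do 2![apply: le_trans (ler_normD _ _) _; rewrite lerD2r]; exact: ler_normD.
  apply: le_trans (n3 _ _ _ _) _; rewrite normrN.
  by have := hvx ez; have := hvx D; lra.
- have -> : bs L j *: vs L j.+1 + als L j *: v + b *: vs L j.-1 - A *m v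
      = eu + ew + ez + D.
    by rewrite ED Ez Ew Eu; apply/colP => i; rewrite !mxE; ring.
  have := enormD (eu + ew + ez) D; have := enormD (eu + ew) ez.
  by have := enormD eu ew; lra.
Qed.

(** With q = 1 + 20 eps >= 1, the step bound be_{i+1} <= q (|A| + be_i) and be_0 = 0 give be_i <= i
    q^i |A| by induction. Normalization carries over because z = 0 is possible only at step k. *)
Lemma lanczos_run_bounds (R : realType) (n : nat) (A : 'M[R]_n) (v : 'cV[R]_n)
    (eps : R) (k : nat) (L : lanczos_data R n) (i : nat) :
  0 <= eps -> 20 * k%:R * eps <= 1 -> lanczos_run A v eps k L -> (i < k)%N ->
  [/\ `|dotv (vs L i.+1) (vs L i.+1) - 1| <= eps, 0 <= bs L i,
      bs L i * enorm (vs L i) <= (1 + eps) * bs L i &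
      bs L i <= specnorm A * i%:R * (1 + 20 * eps) ^+ i].
Proof.
move=> e0 ke [[v0 b0 hv1 _] step].
have a0 := specnorm_ge0 A.
elim: i => [|i IH] ik; first by rewrite v0 b0 !mulr0 !mul0r.
have [hv bi0 bvi bi] := IH (ltnW ik).
have e1 : 20 * eps <= 1.
  apply: le_trans ke; rewrite ler_wpM2r // ler_peMr //.
  by rewrite ler1n (leq_trans _ ik).
have st : lanczos_step A eps k L i.+1 by apply: step; rewrite (ltnW ik).
have [bS0 bS _ _] := lanczos_step_bounds e0 e1 st hv bi0 bvi.
have hv' : `|dotv (vs L i.+2) (vs L i.+2) - 1| <= eps.
  have [_ _ _ _ [znz zz]] := st.
  have [z0|/znz[]//] := eqVneq (zs L i.+1) 0.
  by have [_ ki] := zz z0; rewrite ki ltnn in ik.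
have vi1 : enorm (vs L i.+1) <= 1 + eps.
  apply: enorm_le; first lra.
  move: hv; rewrite ler_distl expr2 => /andP[_].
  have := mulr_ge0 e0 e0; lra.
split => //; first by rewrite mulrC ler_wpM2r.
have q1 : 1 <= (1 + 20 * eps) ^+ i by rewrite exprn_ege1 //; lra.
apply: le_trans bS _; rewrite [leRHS]mulrC exprS -mulrA ler_wpM2l //; first lra.
rewrite -[i.+1%:R]natr1 /=.
have := ler_wpM2l a0 q1; lra.
Qed.

(** * Coordinates of T_k y *)

(** Reading y_j as a product with [stdvec] extends the coordinates by zero to j = 0 and j = k + 1,
    so the first and last rows obey the same formula as the others. *)
Lemma lanczosT_mul (R : realType) (n k : nat) (L : lanczos_data R n)
    (y : 'cV[R]_k) (l : 'I_k) : bs L 0%N = 0 ->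
  (lanczosT L k *m y) l 0 = bs L l * dotv (stdvec R k l) y
    + als L l.+1 * dotv (stdvec R k l.+1) y
    + bs L l.+1 * dotv (stdvec R k l.+2) y.
Proof.
move=> b0; rewrite mxE !dotvE !mulr_sumr -!big_split /=.
apply: eq_bigr => m _; rewrite !mxE !eqSS -val_eqE /= [m == l :> nat]eq_sym.
case: (ltngtP l m) => [lm|ml|lm].
- have -> : (m.+1 == l) = false by apply: gtn_eqF; rewrite ltnS ltnW.
  have -> : (l == m.+1 :> nat) = false by apply: ltn_eqF; rewrite ltnS ltnW.
  by case: eqP => _ /=; ring.
- have -> : (m == l.+1 :> nat) = false by apply: ltn_eqF; rewrite ltnS ltnW.
  rewrite [m.+1 == l]eq_sym.
  by case: (eqVneq (l : nat) m.+1) => [->|_] /=; ring.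
- by rewrite lm gtn_eqF // ltn_eqF //=; ring.
Qed.

Lemma dotv_stdvec (R : realType) (k : nat) (y : 'cV[R]_k) (l : 'I_k) :
  dotv (stdvec R k l.+1) y = y l 0.
Proof.
rewrite dotvE (bigD1 l) //= big1 ?mxE ?eqxx ?mul1r ?addr0 // => m ml.
by rewrite mxE eqSS val_eqE (negPf ml) mul0r.
Qed.

Lemma dotv_stdvec_out (R : realType) (k j : nat) (y : 'cV[R]_k) :
  ~~ (0 < j <= k)%N -> dotv (stdvec R k j) y = 0.
Proof.
move=> jk; rewrite dotvE big1 // => m _; rewrite mxE.
by case: eqP jk => [<-|_ _]; rewrite ?ltn_ord ?mul0r.
Qed.

Lemma norm_dotv_stdvec_le (R : realType) (k j : nat) (y : 'cV[R]_k) :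
  `|dotv (stdvec R k j) y| <= enorm y.
Proof.
have [/andP[]|jk] := boolP (0 < j <= k)%N; last first.
  by rewrite dotv_stdvec_out // normr0 enorm_ge0.
case: j => // j _ jk; rewrite (dotv_stdvec y (Ordinal jk)).
exact: norm_coord_le.
Qed.

Theorem theorem3p4 (R : realType) :
  exists c d : R, 0 < c /\ 0 < d /\
    forall (n kmax : nat) (A : 'M[R]_n) (v : 'cV[R]_n) (eps : R) (k : nat)
           (L : lanczos_data R n),
      (1 <= n)%N -> (1 <= kmax)%N ->
      A^T = A -> v != 0 ->
      0 <= eps -> eps <= 1 / (20%:R * kmax%:R) ->
      (1 <= k <= kmax)%N ->
      lanczos_run A v eps k L ->
      forall (theta : R) (y : 'cV[R]_k),
        lanczosT L k *m y = theta *: y -> enorm y = 1 ->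
        let x := lanczosV L k *m y in
        `|dotv x (vs L k.+1)| * (bs L k * `|dotv (stdvec R k k) y|)
          <= c * (k%:R `^ d) * eps * specnorm A.
Proof.
(* With B = e k |A|, delta = phi = 20 eps B and eta = 2 eps B, the recurrence bound is k (42 + 80 k)
   eps B <= 122 e k^3 eps |A|. *)
exists (124 * sequences.expR 1), 3; split; first by rewrite mulr_gt0 ?expR_gt0.
split=> // n kmax A v eps k L _ kmax0 sA _ e0 ekmax /andP[k0 kk] run theta y.
move=> Ty y1 /=; set x := lanczosV L k *m y.
have k1 : 1 <= k%:R :> R by rewrite ler1n.
have ke : 20 * k%:R * eps <= 1.
  move: ekmax; rewrite ler_pdivlMr ?mulr_gt0 ?ltr0n // => h.
  apply: le_trans h; rewrite [leRHS]mulrC ler_wpM2r // ler_wpM2l //.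
  by rewrite ler_nat.
have e1 : 20 * eps <= 1.
  by apply: le_trans ke; rewrite ler_wpM2r // ler_peMr.
have a0 := specnorm_ge0 A.
have [[v0 b0 _ _] step] := run.
pose B := specnorm A * k%:R * sequences.expR 1.
have rb i : (i < k)%N -> [/\ `|dotv (vs L i.+1) (vs L i.+1) - 1| <= eps,
    0 <= bs L i, bs L i * enorm (vs L i) <= (1 + eps) * bs L i & bs L i <= B].
  move=> ik; have [h1 h2 h3 h4] := lanczos_run_bounds e0 ke run ik.
  split=> //; apply: le_trans h4 _.
  have ik' : i%:R <= k%:R :> R by rewrite ler_nat ltnW.
  rewrite ler_pM ?mulr_ge0 ?exprn_ge0 ?ler_wpM2l //; first lra.
  (* The growth factor is at most exp(20 i eps) <= e, as 20 k eps <= 1. *)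
  have h : (1 + 20 * eps) ^+ i <= sequences.expR (20 * eps) ^+ i.
    by rewrite lerXn2r ?nnegrE ?expR_ge0 ?expR_ge1Dx //; lra.
  apply: le_trans h _; rewrite -expRM_natl ler_expR; apply: le_trans ke.
  by rewrite -[leRHS]mulrA [leRHS]mulrCA ler_wpM2r // mulr_ge0.
have aB : specnorm A <= B.
  rewrite /B -mulrA ler_peMr // mulr_ege1 //.
  by have := expR_ge1Dx (1 : R); lra.
have stb i : (i < k)%N -> [/\ 0 <= bs L i.+1,
    `|bs L i.+1 * dotv (vs L i.+1) (vs L i.+2)| <= 20 * eps * B &
    enorm (bs L i.+1 *: vs L i.+2 + als L i.+1 *: vs L i.+1
             + bs L i *: vs L i - A *m vs L i.+1) <= 20 * eps * B].
  move=> ik; have [h1 h2 h3 h4] := rb _ ik.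
  have st : lanczos_step A eps k L i.+1 by apply: step.
  have [s1 _ s3 s4] := lanczos_step_bounds e0 e1 st h1 h2 h3.
  have hB : 10 * eps * (specnorm A + bs L i) <= 20 * eps * B.
    have : eps * (specnorm A + bs L i) <= eps * (B + B).
      by rewrite ler_wpM2l // lerD.
    lra.
  by split=> //; [exact: le_trans s3 hB | exact: le_trans s4 hB].
have B0 : 0 <= B by exact: le_trans aB.
have eB0 : 0 <= eps * B by exact: mulr_ge0.
have bk0 : 0 <= bs L k.
  by case: (k) k0 stb => // k' _ stb; have [] := stb k' (leqnn _).
pose Y j := dotv (stdvec R k j) y.
(* The extra term i = 0 vanishes because v_0 = 0. *)
have -> : x = \sum_(i < k.+1) Y i *: vs L i.
  rewrite big_ord_recl v0 scaler0 add0r; apply/colP => l.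
  rewrite /x mxE summxE; apply: eq_bigr => m _.
  by rewrite !mxE /Y lift0 dotv_stdvec mulrC.
have -> : bs L k * `|dotv (stdvec R k k) y| = `|bs L k * Y k|.
  by rewrite normrM (ger0_norm bk0).
have key := @three_term_bound R n k A (vs L) (als L) (bs L) Y theta
  (20 * eps * B) (20 * eps * B) (2 * eps * B) sA b0.
apply: le_trans (key _ _ _ _ _ _ _ _) _ => {key}.
- by rewrite /Y dotv_stdvec_out.
- by rewrite /Y dotv_stdvec_out // ltnn.
- move=> i ik; have := lanczosT_mul y (Ordinal ik) b0.
  by rewrite Ty mxE -dotv_stdvec /= => ->.
- by move=> i; rewrite -y1 norm_dotv_stdvec_le.
- case=> [_|i ik]; first by rewrite v0 enorm0.
  have [h1 _ _ _] := rb _ ik; apply: enorm_le => //.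
  by move: h1; rewrite ler_distl => /andP[_]; lra.
- by move=> i ik; have [] := stb _ ik.
- case=> [_|i ik]; last by have [] := stb _ ik.
  by rewrite b0 mul0r normr0; lra.
(* At i = 0 the vector v_0 is not normalized, but be_0 = 0. Later, both squared norms lie within eps
   of 1, whence the factor 2. *)
- case=> [_|i ik]; first by rewrite b0 mul0r normr0; lra.
  have [h1 _ _ _] := rb _ (ltnW ik); have [h2 b2 _ bB] := rb _ ik.
  rewrite normrM mulrC (ger0_norm b2) ler_pM //.
  by move: h1 h2; rewrite !ler_distl; lra.
have -> : k%:R `^ 3 = k%:R ^+ 3 :> R by rewrite powR_mulrn.
have -> : 124 * sequences.expR 1 * k%:R ^+ 3 * eps * specnorm A
    = k%:R * (124 * k%:R * (eps * B)) by rewrite /B; ring.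
rewrite ler_wpM2l //; have := ler_wpM2r eB0 k1; lra.
Qed.
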